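(* Let $A=\bigotimes_{k=1}^n F[x_k,y_k : x_k^p=\alpha_k,\ y_k^p=\beta_k,\ y_kx_k=\rho x_ky_k]$ with $\alpha_k,\beta_k\in F^\times$ be a division algebra. Let $a_1,\dots,a_n$ be integers prime to $p$, let $V_0=F$, and define recursively $V_k=F[x_k]\,y_k+V_{k-1}\,x_k^{a_k}$ for $1\le k\le n$. Then for every $1\le k\le n$, the Kummer subspace $V_k$ of $A$ is maximal with respect to inclusion among the Kummer subspaces of $A$.
   Context: $p$ is a prime number, $n\ge 1$, and $F$ is an infinite field of characteristic not $p$ containing a primitive $p$th root of unity $\rho$. For $\alpha,\beta\in F^\times$, the cyclic algebra $(\alpha,\beta)_{p,F}$ is the $F$-algebra $F[x,y : x^p=\alpha,\ y^p=\beta,\ yx=\rho xy]$ generated by $x,y$ with these relations; tensor products are over $F$, so generators with different indices commute. An element $x\in A$ is called Kummer if $x^p\in F$ and $x^k\notin F$ for every $1\le k\le p-1$. An $F$-vector subspace of $A$ is called Kummer if all its nonzero elements are Kummer. $F[x_k]$ denotes the $F$-subalgebra of $A$ generated by $x_k$. *)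

(* Defs.v *)
From HB Require Import structures.
From mathcomp Require Import all_boot all_order all_algebra all_field.

Set Implicit Arguments.
Unset Strict Implicit.
Unset Printing Implicit Defensive.

Import GRing.Theory.
Local Open Scope ring_scope.

Definition infinite_type (T : eqType) : Prop :=
  forall s : seq T, exists x : T, x \notin s.

Definition cyclic_relations (F : fieldType) (p : nat) (rho alpha beta : F)
    (B : algType F) (x y : B) : Prop :=
  [/\ x ^+ p = alpha%:A, y ^+ p = beta%:A & y * x = rho *: (x * y)].

(* F[x, y : x^p = alpha, y^p = beta, y x = rho x y] is given by the universal
   property of a presentation, so it is determined up to a unique isomorphism.
   An algType is nonzero; nothing is lost by testing against nonzero B only,
   since C is itself nonzero. *)
Definition is_cyclic_algebra (F : fieldType) (p : nat) (rho alpha beta : F)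
    (C : algType F) (x y : C) : Prop :=
  cyclic_relations p rho alpha beta x y /\
  forall (B : algType F) (u v : B), cyclic_relations p rho alpha beta u v ->
    (exists f : {lrmorphism C -> B}, f x = u /\ f y = v) /\
    (forall f g : {lrmorphism C -> B},
       f x = u -> f y = v -> g x = u -> g y = v -> f =1 g).

(* dfwith c u is the family c with its k-th entry replaced by u : C k. *)
Definition multilinear (F : fieldType) (n : nat) (C : 'I_n -> algType F)
    (M : lmodType F) (phi : (forall k, C k) -> M) : Prop :=
  forall (c : forall k, C k) (k : 'I_n) (t : F) (u v : C k),
    phi (dfwith c (t *: u + v)) = t *: phi (dfwith c u) + phi (dfwith c v).

(* A is the tensor product over F of the algebras C k, with iota k the map
   c |-> 1 (x) .. (x) c (x) .. (x) 1.  The pure tensor of a family c is then the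
   product of the iota k (c k), and it is the universal multilinear map; pure
   tensors multiply factorwise because the images of the iota k commute. *)
Definition is_tensor_product (F : fieldType) (n : nat) (C : 'I_n -> algType F)
    (A : algType F) (iota : forall k, {lrmorphism C k -> A}) : Prop :=
  (forall (j k : 'I_n) (u : C j) (v : C k), j != k ->
     iota j u * iota k v = iota k v * iota j u) /\
  forall (M : lmodType F) (phi : (forall k, C k) -> M), multilinear phi ->
    (exists f : {linear A -> M},
       forall c : (forall k, C k), f (\prod_k iota k (c k)) = phi c) /\
    (forall f g : {linear A -> M},
       (forall c : (forall k, C k), f (\prod_k iota k (c k)) = phi c) ->
       (forall c : (forall k, C k), g (\prod_k iota k (c k)) = phi c) ->
       f =1 g).

Definition division_algebra (F : fieldType) (A : falgType F) : Prop :=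
  forall z : A, z != 0 -> z \is a GRing.unit.

(* 1%VS is the line of scalars, i.e. the copy of F inside A. *)
Definition kummer (F : fieldType) (p : nat) (A : falgType F) (z : A) : Prop :=
  z ^+ p \in 1%VS /\
  forall k : nat, (1 <= k <= p.-1)%N -> z ^+ k \notin 1%VS.

Definition kummer_subspace (F : fieldType) (p : nat) (A : falgType F)
    (V : {vspace A}) : Prop :=
  forall z : A, z \in V -> z != 0 -> kummer p z.

Definition maximal_kummer_subspace (F : fieldType) (p : nat) (A : falgType F)
    (V : {vspace A}) : Prop :=
  kummer_subspace p V /\
  forall W : {vspace A}, kummer_subspace p W -> (V <= W)%VS -> W = V.

(* Main.v *)
Require Import Defs.
From HB Require Import structures.
From mathcomp Require Import all_boot all_order all_algebra all_field.

Set Implicit Arguments.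
Unset Strict Implicit.
Unset Printing Implicit Defensive.

Import GRing.Theory.
Local Open Scope ring_scope.

(** Write V for one of the spaces [V k]. If w lies in a Kummer space containing V
    and v is a nonzero element of V, then [(v + t *: w) ^+ p] is scalar for all
    t in the infinite field F, so each of its coefficients as a polynomial in t
    is scalar. The linear coefficient is the sum of the [v ^+ i * w * v ^+ j]
    with i + j = p - 1; up to the scalar [p%:R * v ^+ p] and a factor v, it is
    the projection of w onto the centraliser of v along the other eigenspaces of
    conjugation by v ([eigenproj p v 1 w]). So this projection lies on the line
    of v ([eigenproj_of_power_scalar]), and V is maximal as soon as it contains
    every w with this property for all v in V: call V saturated then
    ([maximal_of_saturated]).

    Saturation passes from U = [V k] to [F[x] y + U x ^+ m]
    ([twisted_saturated]). Decompose w into joint eigenvectors of conjugation by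
    x and by y; these conjugations commute with the projections attached to the
    elements [x ^+ i * y] and [v * x ^+ m], so each component u satisfies the
    property for such elements. If u does not commute with x, then it commutes
    with some [x ^+ i * y], because the eigenvalues are p-th roots of unity and
    p is prime; u is then its own projection, hence a multiple of
    [x ^+ i * y]. If u commutes with x, then [u / x ^+ m] satisfies the property
    for all v in U, so it lies in U. The induction starts at [V 0 = F], which is
    saturated because the projection for v = 1 is the identity.

    That [V k] is Kummer for k > 0 rests on [(f(z) w) ^+ p] being scalar when
    z and w have scalar p-th powers and [w * z = zeta *: (z * w)] with zeta a
    primitive p-th root of unity: this power is the product of the
    [f(zeta ^+ j z)] times [w ^+ p], and that product is a polynomial in
    [z ^+ p] ([skew_horner_exp_scalar]). It applies to [f(x) y], and to
    [u + w = (z + 1) u] with [z = w / u] when u and w commute up to zeta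
    ([skew_add_power_scalar]). *)

(** * Norms of polynomials under a root of unity *)

Section NormPolynomial.

Variable F : fieldType.
Implicit Types (f : {poly F}) (c : F).

Lemma coef_comp_scaleX f c i : (f \Po (c *: 'X))`_i = c ^+ i * f`_i.
Proof.
rewrite coef_comp_poly.
under eq_bigr => j _ do rewrite exprZn coefZ coefXn mulrCA.
case: (ltnP i (size f)) => Hi.
  rewrite (bigD1 (Ordinal Hi)) //= eqxx mulr1 big1 ?addr0 // => j ji.
  by rewrite eq_sym [_ == i](negPf ji) !mulr0.
rewrite (nth_default _ Hi) mulr0 big1 // => j _.
by rewrite (gtn_eqF (leq_trans (ltn_ord j) Hi)) !mulr0.
Qed.

Lemma comp_scaleX_comp f (c d : F) :
  (f \Po (c *: 'X)) \Po (d *: 'X) = f \Po ((c * d) *: 'X).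
Proof. by rewrite -comp_polyA linearZ /= comp_polyX scalerA. Qed.

(** The product is unchanged when the variable is scaled by zeta, since the
    factors are permuted cyclically; its coefficient in degree i is therefore
    fixed by [zeta ^+ i]. *)
Lemma coef_norm_poly p (zeta : F) f i : p.-primitive_root zeta ->
  ~~ (p %| i)%N -> (\prod_(j < p) (f \Po (zeta ^+ j *: 'X)))`_i = 0.
Proof.
move=> prim npi; set G := \prod_(j < p) _.
have GE : G \Po (zeta *: 'X) = G.
  rewrite /G rmorph_prod /=.
  under eq_bigr => j _ do rewrite comp_scaleX_comp -exprSr.
  have := prim_order_gt0 prim; have := prim_expr_order prim.
  case: (p) => // q zq _.
  by rewrite big_ord_recr big_ord_recl /= zq expr0 mulrC.
have := coef_comp_scaleX G zeta i; rewrite GE => /eqP.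
rewrite -subr_eq0 -{1}[G`_i]mul1r -mulrBl mulf_eq0 subr_eq0 eq_sym.
by rewrite -(prim_order_dvd prim) (negPf npi) /= => /eqP.
Qed.

End NormPolynomial.

(** * Powers in the presence of skew commutation *)

Section SkewPower.

Variables (F : fieldType) (A : falgType F).
Implicit Types (u w z : A) (f : {poly F}).

Lemma scalarP z : reflect (exists c : F, z = c%:A) (z \in 1%VS).
Proof. exact: vlineP. Qed.

Lemma skew_exp (c : F) w z i : w * z = c *: (z * w) ->
  w * z ^+ i = c ^+ i *: (z ^+ i * w).
Proof.
move=> wz; elim: i => [|i IH]; first by rewrite !expr0 scale1r mul1r mulr1.
by rewrite !exprS mulrA wz -scalerAl -[z * w * _]mulrA IH -scalerAr !mulrA scalerA.
Qed.

Lemma skew_expl (c : F) w z i : w * z = c *: (z * w) ->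
  w ^+ i * z = c ^+ i *: (z * w ^+ i).
Proof.
move=> wz; elim: i => [|i IH]; first by rewrite !expr0 scale1r mul1r mulr1.
by rewrite !exprS -mulrA IH -scalerAr [w * (z * _)]mulrA wz -scalerAl scalerA
           -mulrA [c ^+ i * c]mulrC.
Qed.

Lemma horner_algE z f : horner_alg z f = \sum_(i < size f) f`_i *: z ^+ i.
Proof.
rewrite -{1}[f]coefK poly_def linear_sum /=; apply: eq_bigr => i _.
by rewrite -mul_polyC rmorphM rmorphXn /= horner_algC horner_algX mulr_algl.
Qed.

Lemma skew_horner (c : F) w z f : w * z = c *: (z * w) ->
  w * horner_alg z f = horner_alg z (f \Po (c *: 'X)) * w.
Proof.
move=> wz; elim/poly_ind: f => [|f b IH]; first by rewrite !rmorph0 mulr0 mul0r.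
have hX : horner_alg z (c *: 'X) = c *: z.
  by rewrite -mul_polyC rmorphM /= horner_algC horner_algX mulr_algl.
rewrite comp_poly_MXaddC !rmorphD !rmorphM /= !horner_algC horner_algX hX.
rewrite mulrDr mulrDl mulr_algr mulr_algl; congr (_ + _).
by rewrite mulrA IH -!mulrA wz -scalerAl.
Qed.

Lemma comm_horner w z f : w * z = z * w ->
  w * horner_alg z f = horner_alg z f * w.
Proof.
move=> wz; have := @skew_horner 1 w z f; rewrite !scale1r comp_polyXr.
exact.
Qed.

(** Moving all the factors w to the right twists the argument of the successive
    factors f(z) by the powers of c. *)
Lemma skew_horner_exp (c : F) w z f i : w * z = c *: (z * w) ->
  (horner_alg z f * w) ^+ i =
  horner_alg z (\prod_(j < i) (f \Po (c ^+ j *: 'X))) * w ^+ i.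
Proof.
move=> wz; elim: i => [|i IH]; first by rewrite big_ord0 !expr0 rmorph1 mulr1.
rewrite exprSr IH -mulrA [w ^+ i * _]mulrA (skew_horner _ (skew_expl i wz)).
by rewrite big_ord_recr /= rmorphM /= -!mulrA -exprSr.
Qed.

(** This covers both [f(x) y] (the norm of f times [y ^+ p]) and, with f = X + 1,
    the additivity of p-th powers of skew commuting elements. *)
Lemma skew_horner_exp_scalar p (zeta : F) w z f : p.-primitive_root zeta ->
  w * z = zeta *: (z * w) -> z ^+ p \in 1%VS -> w ^+ p \in 1%VS ->
  (horner_alg z f * w) ^+ p \in 1%VS.
Proof.
move=> prim wz zp wp; rewrite (skew_horner_exp _ _ wz) -[1%VS]prodv1.
apply: memv_mul => //; rewrite horner_algE; apply: memv_suml => i _.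
case: (boolP (p %| i)%N) => [/dvdnP[q ->]|npi]; last first.
  by rewrite (coef_norm_poly _ prim npi) scale0r mem0v.
case/scalarP: zp => c zp.
by rewrite mulnC exprM zp exprZn expr1n !memvZ ?memv_line.
Qed.
End SkewPower.

(** * Projections onto the eigenspaces of a conjugation *)

Section EigenProjection.

Variables (F : fieldType) (A : falgType F) (p : nat).
Hypotheses (p_gt0 : (0 < p)%N) (p_neq0 : p%:R != 0 :> F).
Implicit Types (u v w z : A) (c : F).

(** When z is invertible, [z ^+ p] is scalar and c is a p-th root of unity, this
    is the projection of w onto the c-eigenspace of conjugation by z, along the
    other ones. *)
Definition eigenproj z c w : A :=
  p%:R^-1 *: \sum_(i < p) c ^- i *: (z ^+ i * w / z ^+ i).

Lemma eigenproj_skew z c d u : z \is a GRing.unit ->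
  z * u = d *: (u * z) -> eigenproj z c u \in <[u]>%VS.
Proof.
move=> zU zu; rewrite memvZ // memv_suml // => i _.
by rewrite memvZ // (skew_expl i zu) -scalerAl mulrK ?unitrX // memvZ ?memv_line.
Qed.

Lemma eigenprojZ z c d u : eigenproj z c (d *: u) = d *: eigenproj z c u.
Proof.
rewrite /eigenproj [RHS]scalerA mulrC -[RHS]scalerA; congr (_ *: _).
rewrite scaler_sumr; apply: eq_bigr => i _.
by rewrite -scalerAr -scalerAl !scalerA mulrC.
Qed.

Lemma eigenproj_line z c d u v : z \is a GRing.unit ->
  z * u = d *: (u * z) -> v \in <[u]>%VS -> eigenproj z c v \in <[u]>%VS.
Proof.
move=> zU zu /vlineP[e ->]; rewrite eigenprojZ memvZ //; exact: eigenproj_skew zu.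
Qed.

Lemma eigenproj_fix z u : z \is a GRing.unit -> z * u = u * z ->
  eigenproj z 1 u = u.
Proof.
move=> zU zu; rewrite /eigenproj.
under eq_bigr => i _ do
  rewrite expr1n invr1 scale1r -(commrX i (esym zu : GRing.comm u z)) mulrK ?unitrX //.
by rewrite sumr_const card_ord -scaler_nat scalerA mulVf ?scale1r.
Qed.

(** Elements that commute up to a scalar induce commuting inner automorphisms. *)
Lemma conj_skewC v w z c : v \is a GRing.unit -> z \is a GRing.unit ->
  v * z = c *: (z * v) -> v * (z * w / z) / v = z * (v * w / v) / z.
Proof.
move=> vU zU vz; have c0 : c != 0.
  apply/eqP=> c0; have : v * z \is a GRing.unit by rewrite unitrMl.
  by rewrite vz c0 scale0r unitr0.
have -> : v * (z * w / z) / v = v * z * w / (v * z) by rewrite invrM // !mulrA.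
have -> : z * (v * w / v) / z = z * v * w / (z * v) by rewrite invrM // !mulrA.
rewrite vz invrZ ?unitfE ?unitrMl //.
by rewrite -scalerAr -!scalerAl scalerA mulVf ?scale1r.
Qed.

Lemma eigenprojC v z c d e w : v \is a GRing.unit -> z \is a GRing.unit ->
  v * z = e *: (z * v) ->
  eigenproj v c (eigenproj z d w) = eigenproj z d (eigenproj v c w).
Proof.
move=> vU zU vz; rewrite /eigenproj.
have expand (x y : A) (a b : F) :
    p%:R^-1 *: (\sum_(i < p) a ^- i *:
      (x ^+ i * (p%:R^-1 *: \sum_(j < p) b ^- j *: (y ^+ j * w / y ^+ j)) / x ^+ i))
    = p%:R^-1 ^+ 2 *: \sum_(i < p) \sum_(j < p) (a ^- i * b ^- j) *:
        (x ^+ i * (y ^+ j * w / y ^+ j) / x ^+ i).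
  rewrite expr2 -scalerA; congr (_ *: _); rewrite [RHS]scaler_sumr; apply: eq_bigr => i _.
  rewrite -scalerAr -scalerAl scalerA mulrC -scalerA; congr (_ *: _).
  rewrite mulr_sumr mulr_suml scaler_sumr; apply: eq_bigr => j _.
  by rewrite -scalerAr -scalerAl scalerA.
rewrite !expand exchange_big /=; congr (_ *: _).
apply: eq_bigr => j _; apply: eq_bigr => i _; rewrite mulrC; congr (_ *: _).
apply: conj_skewC; rewrite ?unitrX //.
exact: skew_expl (skew_exp j vz).
Qed.

Lemma eigenprojP z c w : z \is a GRing.unit -> z ^+ p \in 1%VS ->
  c ^+ p = 1 -> z * eigenproj z c w = c *: (eigenproj z c w * z).
Proof.
move=> zU /scalarP[a zp] cp.
have c0 : c != 0.
  by apply: contra_eq_neq cp => ->; rewrite expr0n gtn_eqF // eq_sym oner_eq0.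
(* Multiplying by z shifts the index of G, which has period p. *)
pose G i := c ^- i *: (z ^+ i * w / z ^+ i).
have GS i : z * G i = c *: (G i.+1 * z).
  rewrite /G -scalerAr -scalerAl scalerA !exprS [(z * _)^-1]invrM ?unitrX //.
  by rewrite invfM mulVKf // !mulrA mulrVK.
have Gp : G p = G 0.
  rewrite /G cp zp invr1 !expr0 !invr1 !scale1r mul1r mulr1.
  by rewrite mulr_algl -(mulr_algr a w) mulrK // -zp unitrX.
rewrite /eigenproj -scalerAr -scalerAl [RHS]scalerA mulrC -scalerA.
congr (_ *: _); rewrite mulr_sumr mulr_suml scaler_sumr.
under eq_bigr => i _ do rewrite -/(G i) GS.
move: Gp; rewrite -(prednK p_gt0) => Gp.
by rewrite big_ord_recr big_ord_recl /= Gp addrC.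
Qed.

Lemma sum_eigenproj (rho : F) z w : p.-primitive_root rho ->
  \sum_(j < p) eigenproj z (rho ^+ j) w = w.
Proof.
move=> prim; rewrite /eigenproj -scaler_sumr exchange_big /=.
rewrite (bigD1 (Ordinal p_gt0)) //= [X in _ + X]big1 ?addr0 => [|i i0].
  under eq_bigr => j _ do rewrite !expr0 !invr1 scale1r mul1r mulr1.
  by rewrite sumr_const card_ord -scaler_nat scalerA mulVf ?scale1r.
rewrite -scaler_suml; have -> : \sum_(j < p) rho ^+ j ^- i = 0; last first.
  by rewrite scale0r.
have r1 : rho ^- i != 1.
  rewrite invr_eq1 -(prim_order_dvd prim) gtnNdvd //.
  by rewrite lt0n; apply: contraNneq i0 => i0; apply/eqP/val_inj.
have : (rho ^- i) ^+ p - 1 = 0.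
  by rewrite exprVn exprAC (prim_expr_order prim) expr1n invr1 subrr.
rewrite subrX1 => /eqP; rewrite mulf_eq0 subr_eq0 (negPf r1) /= => /eqP s0.
rewrite -[RHS]s0; apply: eq_bigr => j _.
by rewrite -!exprVn -!exprM mulnC.
Qed.

End EigenProjection.

(** * Coefficients of polynomials with values in a subspace *)

Section Interpolation.

Variables (F : fieldType) (A : falgType F).
Hypothesis F_infinite : infinite_type F.

Lemma infinite_uniq_seq n : exists s : seq F, uniq s /\ size s = n.
Proof.
elim: n => [|n [s [Us <-]]]; first by exists [::].
by have [x xs] := F_infinite s; exists (x :: s); rewrite /= xs Us.
Qed.

(** Composing with the coordinates of the projection modulo U gives polynomials
    over F with infinitely many roots. *)
Lemma poly_coef_in_subspace (U : {vspace A}) (P : {poly A}) :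
  (forall t : F, P.[t%:A] \in U) -> forall i, P`_i \in U.
Proof.
move=> PU i; pose d (c : A) := c - projv U c.
have dD : {morph d : a b / a + b}.
  by move=> a b; rewrite /d linearD /= opprD addrACA.
have d0 : d 0 = 0 by rewrite /d linear0 subr0.
have dZ c a : d (c *: a) = c *: d a by rewrite /d linearZ /= scalerBr.
suff di : d P`_i = 0 by move/eqP: di; rewrite subr_eq0 => /eqP ->; exact: memv_proj.
rewrite (coord_vbasis (memvf (d P`_i))); apply: big1 => j _.
pose Q := \poly_(k < size P) coord (vbasis fullv) j (d P`_k).
suff Q0 : Q = 0.
  have := coef_poly (size P) (fun k => coord (vbasis fullv) j (d P`_k)) i.
  rewrite -/Q Q0 coef0; case: ltnP => [_ <-|le _]; first by rewrite scale0r.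
  by rewrite (nth_default _ le) d0 linear0 scale0r.
have [s [Us ss]] := infinite_uniq_seq (size P).
apply: (roots_geq_poly_eq0 _ Us); last by rewrite ss size_poly.
apply/allP => t _; apply/rootP.
have : d P.[t%:A] = 0 by rewrite /d projv_id ?subrr.
move=> /(congr1 (coord (vbasis fullv) j)); rewrite linear0 => <-.
rewrite horner_poly horner_coef (big_morph d dD d0) linear_sum.
apply: eq_bigr => k _.
by rewrite exprZn expr1n mulr_algr dZ linearZ /= mulrC.
Qed.

(** The sum is the coefficient of t in [(v + t *: w) ^+ n]. *)
Lemma derivative_in_subspace (U : {vspace A}) (v w : A) n :
  (forall t : F, (v + t *: w) ^+ n \in U) ->
  \sum_(i < n) v ^+ i * w * v ^+ (n.-1 - i) \in U.
Proof.
move=> vwU; pose L := v%:P + w%:P * 'X.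
have L0 k : (L ^+ k)`_0 = v ^+ k.
  elim: k => [|k IH]; first by rewrite !expr0 coefC.
  by rewrite exprS mulrDl coefD -mulrA coefCM IH -commr_polyX mulrA coefMX addr0 exprS.
have L1 k : (L ^+ k)`_1 = \sum_(i < k) v ^+ i * w * v ^+ (k.-1 - i).
  elim: k => [|k IH]; first by rewrite big_ord0 expr0 coefC.
  rewrite exprS mulrDl coefD -mulrA coefCM IH -commr_polyX mulrA coefMX /= coefCM L0.
  rewrite big_ord_recl expr0 mul1r subn0 addrC; congr (_ + _).
  rewrite mulr_sumr; apply: eq_bigr => i _.
  by rewrite lift0 exprS !mulrA /= -subn1 -subnDA add1n.
rewrite -L1; apply: poly_coef_in_subspace => t.
have cLt : comm_poly L t%:A by rewrite /comm_poly mulr_algl mulr_algr.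
rewrite horner_exp_comm // hornerD hornerC hornerMX hornerC mulr_algr.
exact: vwU.
Qed.

(** Multiplying the scalar [\sum_i v ^+ i * w * v ^+ (p.-1 - i)] by a power of v
    turns it into the projection of w onto the centraliser of v; as [v ^+ p] is
    scalar, what results is a multiple of v. *)
Lemma eigenproj_of_power_scalar p (v w : A) : (0 < p)%N ->
  v \is a GRing.unit -> v ^+ p \in 1%VS ->
  (forall t : F, (v + t *: w) ^+ p \in 1%VS) -> eigenproj p v 1 w \in <[v]>%VS.
Proof.
move=> p_gt0 vU /scalarP[a vp] /derivative_in_subspace/scalarP[b Db].
have avU : a%:A \is a @GRing.unit A by rewrite -vp unitrX.
have a0 : a != 0 by apply: contraTneq avU => ->; rewrite scale0r unitr0.
rewrite /eigenproj memvZ //.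
suff -> : \sum_(i < p) 1 ^- i *: (v ^+ i * w / v ^+ i) = (b / a) *: v.
  by rewrite memvZ ?memv_line.
apply: (mulIr (unitrX p.-1 vU)).
rewrite -scalerAl -exprS prednK // vp scalerA divfK // -Db mulr_suml.
apply: eq_bigr => i _; rewrite expr1n invr1 scale1r -[LHS]mulrA; congr (_ * _).
have ip : (i <= p.-1)%N by rewrite -ltnS prednK.
by rewrite -{1}(subnKC ip) exprD mulKr // unitrX.
Qed.

End Interpolation.

(** * Kummer spaces in division algebras *)

Section DivisionAlgebra.

Variables (F : fieldType) (A : falgType F) (p : nat).
Hypotheses (p_prime : prime p) (A_division : division_algebra A).
Implicit Types (u v w x y z : A) (U : {vspace A}).

(** If [z ^+ k] were scalar with k prime to p, a Bezout relation between k and p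
    would make z itself scalar. *)
Lemma kummer_of_nonscalar z : z ^+ p \in 1%VS -> z \notin 1%VS -> kummer p z.
Proof.
move=> zp z1; split=> // k /andP[k0 kp]; apply: contra z1 => zk.
have [->|z0] := eqVneq z 0; first exact: mem0v.
have zU := A_division z0.
case: (egcdnP p k0) => a b abE _; move: abE.
have -> : gcdn k p = 1.
  apply/eqP; rewrite -[_ == _]/(coprime k p) coprime_sym prime_coprime //.
  by rewrite gtnNdvd // -ltnS -(prednK (prime_gt0 p_prime)) ltnS.
move=> abE; have : z ^+ (a * k) = z ^+ (b * p + 1) by rewrite abE.
rewrite exprD expr1 (mulnC a) (mulnC b) !exprM.
case/scalarP: zp => c zp; case/scalarP: zk => d ->; rewrite zp => E.
have c0 : c != 0.
  by apply: contraTneq (unitrX p zU); rewrite zp => ->; rewrite scale0r unitr0.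
have -> : z = c ^- b *: (c%:A ^+ b * z).
  by rewrite exprZn expr1n mulr_algl scalerA mulVf ?scale1r // expf_neq0.
by rewrite -E exprZn expr1n !memvZ ?memv_line.
Qed.

Lemma mem_adjoin_exp x i : x ^+ i \in <<1; x>>%VS.
Proof.
elim: i => [|i IH]; first by rewrite expr0 memvE; exact: sub1_agenv.
by rewrite exprS -[<<1; x>>%VS]agenvM memv_mul ?memv_adjoin.
Qed.

Lemma adjoin_horner x u : x ^+ p \in 1%VS -> u \in <<1; x>>%VS ->
  exists f : {poly F}, u = horner_alg x f.
Proof.
move=> /scalarP[a xp]; pose V := (\sum_(i < p) <[x ^+ i]>)%VS.
have p_gt0 := prime_gt0 p_prime.
have VX i : (i < p)%N -> x ^+ i \in V.
  move=> ip; rewrite memvE.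
  exact: (sumv_sup (Ordinal ip) (P := xpredT) (Vs := fun j : 'I_p => <[x ^+ j]>%VS)).
have V1 : (1 <= V)%VS.
  by rewrite -memvE; have := VX 0 p_gt0; rewrite expr0.
suff sub : (<<1; x>> <= V)%VS.
  move=> /(subvP sub) /memv_sumP[v vX ->].
  have /fin_all_exists[c cE] (i : 'I_p) : exists c, v i = c *: x ^+ i.
    exact/vlineP/vX.
  exists (\sum_i c i *: 'X^i); rewrite linear_sum; apply: eq_bigr => i _.
  by rewrite cE // -mul_polyC rmorphM rmorphXn /= horner_algC horner_algX mulr_algl.
apply: agenv_sub_modl => //; rewrite prodvDl prod1v subv_add subvv /=.
apply/prodvP => _ v /vlineP[c ->] /memv_sumP[w wX ->].
rewrite mulr_sumr memv_suml // => i _; have /vlineP[d ->] := wX i isT.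
rewrite -scalerAl -scalerAr !memvZ // -exprS.
have [ip|] := ltnP i.+1 p; first exact: VX.
move=> pi; have -> : i.+1 = p by apply/eqP; rewrite eqn_leq pi ltn_ord.
by rewrite xp memvZ // memvE.
Qed.

(** The premise on w is what first-order expansion gives when all elements of
    [U + F w] have scalar p-th powers. Being linear in w, it passes to
    eigencomponents of w. *)
Definition saturated U := forall w,
  (forall v, v \in U -> v != 0 -> eigenproj p v 1 w \in <[v]>%VS) -> w \in U.

Lemma maximal_of_saturated U : infinite_type F -> kummer_subspace p U ->
  saturated U ->
  maximal_kummer_subspace p U.
Proof.
move=> F_inf Uk Usat; split=> // W Wk UW; apply/eqP; rewrite eqEsubv UW andbT.
apply/subvP=> w wW; apply: Usat => v vU v0.
have p_gt0 := prime_gt0 p_prime.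
apply: eigenproj_of_power_scalar => //; [exact: A_division|by case: (Uk v vU v0)|].
move=> t; have [->|vw0] := eqVneq (v + t *: w) 0.
  by rewrite expr0n gtn_eqF // mem0v.
by case: (Wk (v + t *: w)) => //; rewrite rpredD ?memvZ // (subvP UW).
Qed.

(** Since [z ^- 1] is a multiple of [z ^+ p.-1], integer exponents can be traded
    for natural ones. *)
Lemma exprz_scalar_exp z (a : int) : z != 0 -> z ^+ p \in 1%VS -> coprimez a p ->
  exists m, coprime m p /\ <[z ^ a]>%VS = <[z ^+ m]>%VS.
Proof.
move=> z0 /scalarP[c zp] ap; have zU := A_division z0.
have c0 : c != 0.
  by apply: contraTneq (unitrX p zU); rewrite zp => ->; rewrite scale0r unitr0.
case: a ap => n np; first by exists n.
exists (n.+1 * p.-1)%N; split.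
  by rewrite coprimeMl coprimePn ?prime_gt0 // andbT.
have E : z ^+ (n.+1 * p.-1) = c ^+ n.+1 *: (z ^ (Negz n)).
  apply: (mulIr (unitrX n.+1 zU)); rewrite -exprD -mulnSr prednK ?prime_gt0 //.
  by rewrite mulnC exprM zp exprZn expr1n NegzE -scalerAl /exprz mulVr ?unitrX.
apply/eqP; rewrite eqEsubv -!memvE E memvZ ?memv_line //= andbT.
by apply/vlineP; exists (c ^- n.+1); rewrite scalerA mulVf ?scale1r // expf_neq0.
Qed.

Variable rho : F.
Hypothesis rho_prim : p.-primitive_root rho.

(** With [z = w / u], the sum [u + w] is [(z + 1) * u], where u and z commute up
    to zeta. *)
Lemma skew_add_power_scalar (zeta : F) u w : p.-primitive_root zeta ->
  u * w = zeta *: (w * u) -> u ^+ p \in 1%VS -> w ^+ p \in 1%VS ->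
  (u + w) ^+ p \in 1%VS.
Proof.
move=> prim uw /[dup] up /scalarP[a upE] wp.
have [->|u0] := eqVneq u 0; first by rewrite add0r.
have uU := A_division u0; pose z := w / u.
have wE : w = z * u by rewrite mulrVK.
have a0 : a != 0.
  by apply: contraTneq (unitrX p uU); rewrite upE => ->; rewrite scale0r unitr0.
have uz : u * z = zeta *: (z * u).
  by rewrite /z mulrA uw -scalerAl mulrK // mulrVK.
have zeta0 : zeta != 0.
  apply: contra_eq_neq (prim_expr_order prim) => ->.
  by rewrite expr0n gtn_eqF ?prime_gt0 // eq_sym oner_neq0.
have zp : z ^+ p \in 1%VS.
  have prim' : p.-primitive_root zeta^-1.
    have -> : zeta^-1 = zeta ^+ p.-1.
      apply: (mulfI zeta0); rewrite divff // -exprS prednK ?prime_gt0 //.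
      by rewrite (prim_expr_order prim).
    by rewrite prim_root_exp_coprime // coprimePn ?prime_gt0.
  have uw' : u^-1 * w = zeta^-1 *: (w / u).
    apply: (mulrI uU); rewrite mulVKr // -scalerAr mulrA uw -scalerAl mulrK //.
    by rewrite scalerA mulVf ?scale1r.
  have -> : z = horner_alg w 'X / u by rewrite horner_algX.
  apply: (skew_horner_exp_scalar _ prim') => //.
  by rewrite exprVn upE invrZ ?unitfE ?unitr1 // invr1 memvZ ?memv_line.
have -> : u + w = horner_alg z ('X + 1) * u.
  by rewrite rmorphD rmorph1 /= horner_algX mulrDl mul1r -wE addrC.
exact: (skew_horner_exp_scalar _ prim).
Qed.

(** * One step of the recursion *)

Section TwistedExtension.

Variables (x y : A) (m : nat) (U : {vspace A}).
Hypotheses (x0 : x != 0) (y0 : y != 0) (yx : y * x = rho *: (x * y)).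
Hypotheses (xp : x ^+ p \in 1%VS) (yp : y ^+ p \in 1%VS).
Hypotheses (m_coprime : coprime m p).
Hypotheses (Ux : (U <= 'C[x])%VS) (Uy : (U <= 'C[y])%VS).

Let W := (<<1; x>> * <[y]> + U * <[x ^+ m]>)%VS.
Let xU := A_division x0.
Let yU := A_division y0.

Lemma twisted_memP s : s \in W ->
  exists f : {poly F}, exists2 v, v \in U & s = horner_alg x f * y + v * x ^+ m.
Proof.
case/memv_addP=> _ /memv_cosetP[u uX ->] [_ /memv_cosetP[v vU ->] ->].
by have [f ->] := adjoin_horner xp uX; exists f, v.
Qed.

Lemma twisted_sub_cent z : (U <= 'C[z])%VS -> x \in 'C[z]%VS -> y \in 'C[z]%VS ->
  (W <= 'C[z])%VS.
Proof.
move=> Uz xz yz; rewrite subv_add !prodv_sub //=.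
- by rewrite -memvE; apply/cent1vP/esym/commrX/esym/cent1vP.
- apply: agenv_sub_modl; first by rewrite -memvE cent1v1.
  by rewrite prodv_sub // subv_add -!memvE cent1v1.
Qed.

(** The two summands [f(x) y] and [v * x ^+ m] commute up to [rho ^+ m]. *)
Lemma twisted_power_scalar : (forall v, v \in U -> v ^+ p \in 1%VS) ->
  forall s, s \in W -> s ^+ p \in 1%VS.
Proof.
move=> Up s /twisted_memP[f [v vU ->]].
have /cent1vP vx := subvP Ux v vU; have /cent1vP vy := subvP Uy v vU.
have prim : p.-primitive_root (rho ^+ m) by rewrite prim_root_exp_coprime.
apply: (skew_add_power_scalar prim).
- have hx : x ^+ m * horner_alg x f = horner_alg x f * x ^+ m.
    exact/comm_horner/esym/commrX.
  have hv : v * horner_alg x f = horner_alg x f * v by apply: comm_horner.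
  rewrite -[LHS]mulrA [y * (v * _)]mulrA -vy -[v * y * _]mulrA (skew_exp m yx).
  by rewrite -!scalerAr mulrA -hv -!mulrA [x ^+ m * (_ * y)]mulrA hx !mulrA.
- exact: (skew_horner_exp_scalar _ rho_prim).
- rewrite exprMn_comm; last by apply: commrX.
  rewrite -[1%VS]prodv1; apply: memv_mul; first exact: Up.
  by rewrite exprAC; case/scalarP: xp => c ->; rewrite exprZn expr1n memvZ ?memv_line.
Qed.

(** A scalar [f(x) y + v * x ^+ m] commutes with x, which forces [f(x) y = 0];
    what is left commutes with y, which forces it to vanish too. *)
Lemma twisted_nonscalar s : s \in W -> s != 0 -> s \notin 1%VS.
Proof.
move=> /twisted_memP[f [v vU ->]]; set u := _ * y; set w := v * _ => s0.
have /cent1vP vx := subvP Ux v vU; have /cent1vP vy := subvP Uy v vU.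
have rho_neq1 : rho - 1 != 0.
  by rewrite subr_eq0 -[rho]expr1 -(prim_order_dvd rho_prim) dvdn1 gtn_eqF ?prime_gt1.
have rhom_neq1 : rho ^+ m - 1 != 0.
  rewrite subr_eq0 -(prim_order_dvd rho_prim); apply: contraL m_coprime => pm.
  by rewrite coprime_sym prime_coprime // pm.
apply: contra_neqN s0 => /scalarP[c sc].
have ux : u * x = rho *: (x * u).
  rewrite /u -mulrA yx -scalerAr !mulrA; congr (_ *: (_ * _)).
  exact/esym/comm_horner.
have wx : w * x = x * w by rewrite /w -mulrA -exprSr exprS !mulrA vx.
have yw : y * w = rho ^+ m *: (w * y).
  by rewrite /w mulrA -vy -mulrA (skew_exp m yx) -scalerAr mulrA.
have u0 : u = 0.
  have : (u + w) * x = x * (u + w) by rewrite sc mulr_algl mulr_algr.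
  rewrite mulrDl mulrDr wx ux => /addIr/eqP; rewrite -subr_eq0 -{2}[x * u]scale1r.
  rewrite -scalerBl scaler_eq0 (negPf rho_neq1) /= => /eqP/(congr1 ( *%R x^-1)).
  by rewrite mulKr // mulr0.
move: sc; rewrite u0 !add0r => sc.
have : y * w = w * y by rewrite sc mulr_algl mulr_algr.
rewrite yw => /eqP; rewrite -subr_eq0 -{2}[w * y]scale1r.
rewrite -scalerBl scaler_eq0 (negPf rhom_neq1) /= => /eqP/(congr1 ( *%R^~ y^-1)).
by rewrite mulrK // mul0r.
Qed.

Hypothesis p_neq0 : p%:R != 0 :> F.

(** Every joint eigencomponent u of w lies in [F[x] y] if it does not commute
    with x, and in [U x ^+ m] if it does. *)
Lemma twisted_saturated :
  saturated U -> saturated W.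
Proof.
move=> Usat w Ww.
have p_gt0 := prime_gt0 p_prime.
have rp := prim_expr_order rho_prim.
have rU : rho != 0.
  apply: contra_eq_neq rp => ->; by rewrite expr0n gtn_eqF // eq_sym oner_neq0.
have yxC c d z : eigenproj p y c (eigenproj p x d z) =
    eigenproj p x d (eigenproj p y c z).
  exact: (eigenprojC p c d z yU xU yx).
rewrite -(sum_eigenproj p_gt0 p_neq0 x w rho_prim) memv_suml // => i _.
rewrite -(sum_eigenproj p_gt0 p_neq0 y (eigenproj _ _ _ _) rho_prim).
rewrite memv_suml // => j _; set u := eigenproj _ _ _ _.
have yu : y * u = rho ^+ j *: (u * y).
  by apply: eigenprojP => //; rewrite exprAC rp expr1n.
have xu : x * u = rho ^+ i *: (u * x).
  by rewrite /u yxC; apply: eigenprojP => //; rewrite exprAC rp expr1n.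
(* A test vector v that is itself a joint eigenvector transfers the hypothesis
   on w to the component u. *)
have fixline v (a b : F) : v \in W -> v != 0 -> y * v = a *: (v * y) ->
    x * v = b *: (v * x) -> eigenproj p v 1 u \in <[v]>%VS.
  move=> vW v0 yv xv; have vU := A_division v0.
  rewrite /u -(eigenprojC _ _ _ _ yU vU yv) -(eigenprojC _ _ _ _ xU vU xv).
  apply: eigenproj_line yU yv _; apply: eigenproj_line xU xv _; exact: Ww.
have [i0|i0] := eqVneq (val i) 0%N; last first.
  have ip : coprime i p.
    by rewrite coprime_sym prime_coprime // gtnNdvd // lt0n.
  have /(prim_rootP (_ : p.-primitive_root (rho ^+ i)))[|k rk] : (rho ^- j) ^+ p = 1.
  - by rewrite exprVn exprAC rp expr1n invr1.
  - by rewrite prim_root_exp_coprime.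
  (* k is chosen so that the y-eigenvalue of u cancels against the k-th power
     of its x-eigenvalue. *)
  set v := x ^+ k * y.
  have v0 : v != 0.
    have : v \is a GRing.unit by rewrite unitrMl // unitrX.
    by apply: contraTneq => ->; rewrite unitr0.
  have vW : v \in W.
    by apply/(subvP (addvSl _ _))/memv_mul; rewrite ?mem_adjoin_exp ?memv_line.
  have yv : y * v = rho ^+ k *: (v * y).
    by rewrite /v mulrA (skew_exp k yx) -scalerAl.
  have xv : x * v = rho^-1 *: (v * x).
    rewrite /v -mulrA yx -scalerAr scalerA mulVf // scale1r mulrA -exprS.
    by rewrite exprSr -mulrA.
  have vu : v * u = u * v.
    rewrite /v -mulrA yu -scalerAr [_ * (u * y)]mulrA (skew_expl k xu) -scalerAl scalerA.
    by rewrite -rk divff ?scale1r ?mulrA // expf_neq0.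
  have := fixline v _ _ vW v0 yv xv.
  rewrite (eigenproj_fix p_neq0 (A_division v0) vu) => /vlineP[c ->].
  by rewrite memvZ.
move: xu; rewrite i0 expr0 scale1r => xu.
have xmU : x ^+ m \is a GRing.unit by rewrite unitrX.
(* Here conjugation by v * x ^+ m acts on u as conjugation by v does. *)
suff uU : u / x ^+ m \in U.
  apply/(subvP (addvSr _ _)); rewrite -[u](mulrVK xmU).
  by rewrite memv_mul ?memv_line.
apply: Usat => v vU v0; set vx := v * x ^+ m.
have /cent1vP cvx := subvP Ux v vU; have /cent1vP cvy := subvP Uy v vU.
have cvxm : v * x ^+ m = x ^+ m * v by apply: commrX.
have vx0 : vx != 0.
  have : vx \is a GRing.unit by rewrite unitrMl // A_division.
  by apply: contraTneq => ->; rewrite unitr0.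
have vxW : vx \in W.
  by apply/(subvP (addvSr _ _)); rewrite memv_mul ?memv_line.
have := fixline vx (rho ^+ m) 1 vxW vx0; case/(_ _ _)/vlineP.
- by rewrite /vx mulrA -cvy -mulrA (skew_exp m yx) -scalerAr mulrA.
- by rewrite /vx mulrA -cvx -!mulrA -exprS exprSr scale1r.
move=> c uvx; apply/vlineP; exists c; apply: (mulIr xmU).
rewrite -[RHS]scalerAl -/vx -uvx /eigenproj -scalerAl; congr (_ *: _).
rewrite mulr_suml; apply: eq_bigr => k _; rewrite -scalerAl; congr (_ *: _).
have vU' := A_division v0.
have cxmk : GRing.comm (v ^+ k) (x ^+ m) by apply/commr_sym/commrX/commr_sym.
have cuxm : u * (x ^+ m) ^+ k = (x ^+ m) ^+ k * u.
  by apply: commrX; apply: commrX.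
rewrite exprMn_comm // invrM ?unitrX //.
have cinv : (x ^+ m)^-1 / v ^+ k = v ^- k / x ^+ m.
  by rewrite -!invrM ?unitrX // cxmk.
have -> : v ^+ k * (u / x ^+ m) / v ^+ k = v ^+ k * u * (v ^- k / x ^+ m).
  by rewrite -cinv !mulrA.
rewrite -[v ^+ k * _ ^+ k * u]mulrA -cuxm !mulrA mulrVK //.
by rewrite mulrK // unitrX.
Qed.

End TwistedExtension.
End DivisionAlgebra.

(** * Maximality *)

(* The tensor product of cyclic algebras is finite-dimensional, so taking A to
   be a falgType is no restriction, and {vspace A} is then the type of all its
   F-subspaces. Indices run over 'I_n, hence V k.+1 is built from x k, y k. *)
Theorem theorem2p1
  (p n : nat) (p_prime : prime p) (n_gt0 : (0 < n)%N)
  (F : fieldType) (F_infinite : infinite_type F)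
  (F_char : p \notin [pchar F])
  (rho : F) (rho_prim : p.-primitive_root rho)
  (alpha beta : 'I_n -> F)
  (alpha_neq0 : forall k, alpha k != 0) (beta_neq0 : forall k, beta k != 0)
  (C : 'I_n -> algType F) (xC yC : forall k, C k)
  (C_cyclic : forall k,
     is_cyclic_algebra p rho (alpha k) (beta k) (xC k) (yC k))
  (A : falgType F) (iota : forall k, {lrmorphism C k -> A})
  (A_tensor : is_tensor_product iota)
  (A_division : division_algebra A)
  (x y : 'I_n -> A)
  (x_def : forall k, x k = iota k (xC k)) (y_def : forall k, y k = iota k (yC k))
  (a : 'I_n -> int) (a_coprime : forall k, coprimez (a k) p)
  (V : nat -> {vspace A})
  (V_0 : V 0%N = 1%VS)
  (V_rec : forall k : 'I_n,
     V k.+1 = (<<1; x k>> * <[y k]> + V k * <[x k ^ a k]>)%VS) :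
  forall k : nat, (1 <= k <= n)%N -> maximal_kummer_subspace p (V k).
Proof.
have p_gt0 := prime_gt0 p_prime.
have p_neq0 : p%:R != 0 :> F.
  by apply: contraNneq F_char => p0; rewrite inE p_prime p0 eqxx.
have scalar_power k :
    [/\ x k ^+ p = (alpha k)%:A, y k ^+ p = (beta k)%:A
      & y k * x k = rho *: (x k * y k)].
  case: (C_cyclic k) => -[xp yp yx] _.
  split; rewrite ?x_def ?y_def.
  - by rewrite -rmorphXn xp /= linearZ /= rmorph1.
  - by rewrite -rmorphXn yp /= linearZ /= rmorph1.
  - by rewrite -!rmorphM yx /= linearZ.
have comm_gen j k (u : C j) (v : C k) : j != k ->
    iota j u * iota k v = iota k v * iota j u by apply: A_tensor.1.
have nz (c : F) (z : A) : c != 0 -> z ^+ p = c%:A -> z != 0.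
  move=> c0; apply: contra_eq_neq => ->.
  by rewrite expr0n gtn_eqF //= eq_sym scaler_eq0 oner_eq0 orbF.
(* The induction starts at V 0, which is saturated although it is not Kummer. *)
pose good k := [/\ (forall j : 'I_n, (k <= j)%N ->
     (V k <= 'C[x j])%VS /\ (V k <= 'C[y j])%VS),
   (forall v, v \in V k -> v ^+ p \in 1%VS) & saturated p (V k)].
have step k : (k < n)%N -> good k -> good k.+1 /\ kummer_subspace p (V k.+1).
  move=> kn; set i := Ordinal kn; case=> Vcent Vpow Vsat.
  have [xp yp yx] := scalar_power i.
  have x0 := nz _ _ (alpha_neq0 i) xp; have y0 := nz _ _ (beta_neq0 i) yp.
  have xp1 : x i ^+ p \in 1%VS by rewrite xp memvZ ?memv_line.
  have yp1 : y i ^+ p \in 1%VS by rewrite yp memvZ ?memv_line.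
  have [Vx Vy] := Vcent i (leqnn _).
  have [m [mp am]] := exprz_scalar_exp p_prime A_division x0 xp1 (a_coprime i).
  have VE : V k.+1 = (<<1; x i>> * <[y i]> + V k * <[x i ^+ m]>)%VS.
    by rewrite -am; exact: V_rec i.
  have pow v : v \in V k.+1 -> v ^+ p \in 1%VS.
    by rewrite VE; apply: (twisted_power_scalar p_prime A_division rho_prim).
  split; last first.
    move=> z zV z0; apply: kummer_of_nonscalar => //; first exact: pow.
    by move: z zV z0; rewrite VE; apply: (twisted_nonscalar p_prime A_division rho_prim).
  split=> // [j kj|]; last first.
    by rewrite /saturated VE; apply: (twisted_saturated p_prime A_division rho_prim).
  have ij : i != j by rewrite -val_eqE /= ltn_eqF.
  have [Vxj Vyj] := Vcent j (ltnW kj).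
  by split; rewrite VE; apply: (twisted_sub_cent m) => //; apply/cent1vP;
    rewrite !(x_def, y_def) comm_gen.
have all_good k : (k <= n)%N -> good k.
  elim: k => [|k IH] kn; last by case: (step k kn (IH (ltnW kn))).
  split; rewrite V_0.
  - by move=> j _; rewrite -!memvE !cent1v1.
  - by move=> v /scalarP[c ->]; rewrite exprZn expr1n memvZ ?memv_line.
  - move=> w /(_ 1 (memv_line 1) (oner_neq0 _)).
    by rewrite (eigenproj_fix p_neq0 (unitr1 _)) // mul1r mulr1.
case=> // k /andP[_ kn].
have [[_ _ Vsat] Vk] := step k kn (all_good k (ltnW kn)).
exact: maximal_of_saturated.
Qed.
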